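(* If $A$ is a compact positive definite metric space and $\{A_k\}$ is a sequence of (nonempty) compact subspaces of $A$ such that $\lim_{k\to\infty} d_H(A_k,A) = 0$, then $|A| = \lim_{k\to\infty} |A_k|$.
   Context: Metric spaces are nonempty. For a finite metric space $(B,d)$, its similarity matrix is $\zeta_B \in \mathbb{R}^{B\times B}$, $\zeta_B(x,y)=e^{-d(x,y)}$; a metric space $A$ is positive definite if $\zeta_B$ is a positive definite matrix for every nonempty finite subset $B \subseteq A$ (with the induced metric). $M(A)$ is the space of finite signed Borel measures on $A$. For compact $(A,d)$, $Z_A(\mu,\nu) = \int_A\int_A e^{-d(x,y)}\,d\mu(x)\,d\nu(y)$ for $\mu,\nu\in M(A)$. The magnitude of a compact positive definite metric space $A$ is $|A| = \sup\{\mu(A)^2/Z_A(\mu,\mu) : \mu\in M(A),\ Z_A(\mu,\mu)\neq 0\}\in[1,\infty]$. The Hausdorff distance between subsets $S,T$ of a metric space is $d_H(S,T) = \max\{\sup_{s\in S} d(s,T),\ \sup_{t\in T} d(t,S)\}$. *)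

(* Defs.v *)
From HB Require Import structures.
From mathcomp Require Import all_boot all_order all_algebra finmap.
From mathcomp Require Import all_classical all_reals all_analysis.

Set Implicit Arguments.
Unset Strict Implicit.
Unset Printing Implicit Defensive.

Import Order.TTheory GRing.Theory Num.Theory.
Import numFieldNormedType.Exports.

Local Open Scope classical_set_scope.
Local Open Scope ring_scope.

(* Nonempty metric spaces. The base point is only there because the library's
   measurable types are pointed; nothing below depends on its choice. *)
#[short(type="pmetricType")]
HB.structure Definition PointedMetric (K : numDomainType) :=
  {M of Pointed M & Metric K M}.

Section subspace_metric.
Context {R : realType} {T : metricType R}.

Section induced_metric.
Variable S : set T.

Let sub_mdist (x y : S) : R := mdist (\val x) (\val y).

Let sub_mdist_ge0 x y : 0 <= sub_mdist x y.
Proof. exact: mdist_ge0. Qed.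

Let sub_mdist_positivity x y : sub_mdist x y = 0 -> x = y.
Proof. by move=> /mdist_positivity/val_inj. Qed.

Let sub_ballEmdist (x : S) (d : R) : ball x d = [set y | sub_mdist x y < d].
Proof. by rewrite /ball/= /sub_mdist /initial_ball ballEmdist. Qed.

HB.instance Definition _ := PseudoMetric_isMetric.Build R (S : Type)
  sub_mdist_ge0 sub_mdist_positivity sub_ballEmdist.

End induced_metric.

(* The subtype [set_type S] with its induced metric, as a nonempty metric
   space; the alias carries the proof of nonemptiness. *)
Definition subspace_of (S : set T) (S0 : S !=set0) : Type := S.

Variables (S : set T) (S0 : S !=set0).

Let subspace_point : S := exist _ (projT1 (cid S0)) (mem_set (projT2 (cid S0))).

HB.instance Definition _ := Metric.copy (subspace_of S0) (S : Type).
HB.instance Definition _ := isPointed.Build (subspace_of S0) subspace_point.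

End subspace_metric.

Section positive_definite.
Context {R : realType}.

Definition posdefmx n (M : 'M[R]_n) : Prop :=
  M^T = M /\ forall u : 'cV[R]_n, u != 0 -> 0 < (u^T *m M *m u) 0 0.

(* The rows and columns are indexed by the enumeration of the finite type [B]. *)
Definition similarity_mx (T : metricType R) (B : {fset T}) : 'M[R]_#|{: B}| :=
  \matrix_(i, j) expR (- mdist (\val (enum_val i)) (\val (enum_val j))).

Definition positive_definite (T : metricType R) : Prop :=
  forall B : {fset T}, B != fset0 -> posdefmx (similarity_mx B).

End positive_definite.

Section charge_integral.
Context d (T : measurableType d) (R : realType).
Implicit Types nu : {charge set T -> \bar R}.

Lemma Hahn_decomposition_sig nu :
  {PN : set T * set T | hahn_decomposition nu PN.1 PN.2}.
Proof.
by apply: cid; have [P [N PN]] := Hahn_decomposition nu; exists (P, N).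
Qed.

Definition charge_pos nu : {finite_measure set T -> \bar R} :=
  jordan_pos (svalP (Hahn_decomposition_sig nu)).

Definition charge_neg nu : {finite_measure set T -> \bar R} :=
  jordan_neg (svalP (Hahn_decomposition_sig nu)).

(* Meaningful when [f] is integrable for both parts of the Jordan decomposition
   of [nu], e.g. when [f] is bounded and measurable. *)
Definition charge_integral nu (f : T -> R) : R :=
  \int[charge_pos nu]_x f x - \int[charge_neg nu]_x f x.

End charge_integral.

Section magnitude.
Context {R : realType}.

Definition borel (T : pmetricType R) := g_sigma_algebraType (@open T).

Definition signed_measure (T : pmetricType R) :=
  {charge set (borel T) -> \bar R}.

Definition similarity_form (T : pmetricType R) (mu nu : signed_measure T) : R :=
  charge_integral nu (fun y : T =>
    charge_integral mu (fun x : T => expR (- mdist x y))).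

Definition magnitude (T : pmetricType R) : \bar R :=
  ereal_sup [set ((fine (mu [set: T])) ^+ 2 / similarity_form mu mu)%:E |
    mu in [set mu : signed_measure T | similarity_form mu mu != 0]].

End magnitude.

Section hausdorff_distance.
Context {R : realType} {T : metricType R}.
Local Open Scope ereal_scope.

Definition dist_to_set (x : T) (S : set T) : \bar R :=
  ereal_inf [set (mdist x y)%:E | y in S].

Definition hausdorff_dist (S U : set T) : \bar R :=
  maxe (ereal_sup [set dist_to_set s U | s in S])
       (ereal_sup [set dist_to_set u S | u in U]).

End hausdorff_distance.

(* Main.v *)
Require Import Defs.
From mathcomp Require Import all_boot all_order all_algebra finmap.
From mathcomp Require Import all_classical all_reals all_analysis.
From mathcomp Require Import measurable_realfun lra.

(** The magnitude is a supremum of quotients [mu(A)^2 / Z(mu, mu)], and both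
    inequalities between the magnitudes of [A] and of its subspaces are obtained
    by transporting signed measures along maps.

    A measurable map [f] from [T] to [U] sends a signed measure [mu] on [T] to
    its image on [U], with the same total mass. Changing variables, the
    similarity form of the image is the double integral of
    [exp (- d(f x, f y))] against [mu], so if [f] changes distances by at most
    [e], the similarity form changes by at most [e * |mu|^2], where [|mu|] is
    the total variation norm ([similarity_form_distortion]).

    Upper bound. The inclusion of a subspace is an isometry, so the quotients
    available on the subspace are among those available on [A]
    ([le_magnitude_subspace]).

    Lower bound. Fix [mu] on [A] with nonzero similarity form. When [A_k] is
    Hausdorff-close to the compact space [A], there is a measurable map from [A]
    to [A_k], with finite range, that moves every point by little
    ([subspace_almost_isometry]). The image of [mu] under it has a similarity
    form close to that of [mu], hence nonzero, and a quotient close to the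
    original one ([magnitude_lower_approx]). Therefore the magnitude of [A_k]
    eventually exceeds every real below any quotient of [A]; together with the
    upper bound this is convergence to the supremum, finite or not
    ([cvg_ereal_sup]). *)

Import Order.TTheory GRing.Theory Num.Theory.
Import numFieldNormedType.Exports.
Local Open Scope classical_set_scope.
Local Open Scope ring_scope.

Set Implicit Arguments.
Unset Strict Implicit.
Unset Printing Implicit Defensive.

(** * Integration against a finite signed measure *)
Section charge_integral_theory.
Context d (T : measurableType d) (R : realType).
Implicit Types (nu : {charge set T -> \bar R}) (f g : T -> R).

Definition bounded_measurable f :=
  measurable_fun [set: T] f /\ exists M, forall x, `|f x| <= M.

(** The norm of [nu] in total variation. *)
Definition charge_norm nu : R :=
  fine (charge_pos nu [set: T]) + fine (charge_neg nu [set: T]).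

Lemma charge_jordanE nu A : measurable A ->
  nu A = (charge_pos nu A - charge_neg nu A)%E.
Proof.
move=> mA; have := jordan_decomp (svalP (Hahn_decomposition_sig nu)) mA.
by rewrite /cadd/= cscaleN1.
Qed.

Lemma bounded_measurable_integrable (m : {measure set T -> \bar R}) f :
  (m [set: T] < +oo)%E -> bounded_measurable f ->
  m.-integrable [set: T] (EFin \o f).
Proof.
move=> moo [mf [M fM]]; apply: measurable_bounded_integrable => //.
exists M; split; first exact: num_real.
by move=> N MN x _ /=; rewrite (le_trans (fM x))// ltW.
Qed.

(** The integral against a signed measure can be computed from any way of
    writing it as a difference of two finite measures. If
    [m1 - m2 = pos - neg] then [pos + m2] and [m1 + neg] are the same measure;
    integrate [f] against both and rearrange. This frees later arguments from
    the chosen Hahn decomposition, which image measures do not respect. *)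
Lemma charge_integralE nu (m1 m2 : {measure set T -> \bar R}) f :
  (m1 [set: T] < +oo)%E -> (m2 [set: T] < +oo)%E ->
  (forall A, measurable A -> nu A = (m1 A - m2 A)%E) ->
  bounded_measurable f ->
  charge_integral nu f = \int[m1]_x f x - \int[m2]_x f x.
Proof.
move=> m1oo m2oo numE bf.
pose p : {measure set T -> \bar R} := charge_pos nu.
pose n : {measure set T -> \bar R} := charge_neg nu.
have poo : (p [set: T] < +oo)%E by rewrite ltey_eq fin_num_measure.
have noo : (n [set: T] < +oo)%E by rewrite ltey_eq fin_num_measure.
have int (m : {measure set T -> \bar R}) : (m [set: T] < +oo)%E ->
    m.-integrable [set: T] (EFin \o f).
  by move=> moo; exact: bounded_measurable_integrable.
have fin (m : {measure set T -> \bar R}) A : (m [set: T] < +oo)%E ->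
    measurable A -> m A \is a fin_num.
  move=> moo mA; rewrite ge0_fin_numE// (le_lt_trans _ moo)// le_measure ?inE//.
have mE A : measurable A -> measure_add p m2 A = measure_add m1 n A.
  move=> mA; rewrite !measure_addE.
  have nuA : (p A - n A = m1 A - m2 A)%E by rewrite -numE// charge_jordanE.
  move: nuA.
  rewrite -(fineK (fin p A poo mA)) -(fineK (fin n A noo mA)).
  rewrite -(fineK (fin m1 A m1oo mA)) -(fineK (fin m2 A m2oo mA)).
  rewrite -!EFinD => -[h]; congr EFin; lra.
have := @eq_measure_integral _ _ _ setT _ _ (EFin \o f) (fun A mA _ => mE A mA).
rewrite !integral_measure_add//; [|exact: int..].
rewrite /charge_integral /Rintegral -/p -/n.
have ifin (m : {measure set T -> \bar R}) : (m [set: T] < +oo)%E ->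
   (\int[m]_x (f x)%:E)%E \is a fin_num.
  by move=> moo; apply: integrable_fin_num => //; exact: int.
rewrite -(fineK (ifin _ poo)) -(fineK (ifin _ noo)).
rewrite -(fineK (ifin _ m1oo)) -(fineK (ifin _ m2oo)).
rewrite -!EFinD/= => -[h]; lra.
Qed.

Lemma charge_integralB nu f g : bounded_measurable f -> bounded_measurable g ->
  charge_integral nu (fun x => f x - g x) =
  charge_integral nu f - charge_integral nu g.
Proof.
move=> bf bg; rewrite /charge_integral !RintegralB//; first lra.
all: apply: bounded_measurable_integrable => //.
all: by rewrite ltey_eq fin_num_measure.
Qed.

Lemma normr_charge_integral_le nu f M : measurable_fun [set: T] f ->
  (forall x, `|f x| <= M) -> `|charge_integral nu f| <= M * charge_norm nu.
Proof.
move=> mf fM; have bf : bounded_measurable f by split=> //; exists M.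
have bnd (m : {measure set T -> \bar R}) : (m [set: T] < +oo)%E ->
    `|\int[m]_x f x| <= M * fine (m [set: T]).
  move=> moo; have fi := bounded_measurable_integrable moo bf.
  rewrite (le_trans (le_normr_Rintegral _ fi))//.
  rewrite -Rintegral_cst//; apply: le_Rintegral => //.
  - exact: (integrable_norm fi).
  - apply: bounded_measurable_integrable => //; split=> //.
    by exists `|M|.
rewrite /charge_integral /charge_norm mulrDr.
by rewrite (le_trans (ler_normB _ _))// lerD// bnd// ltey_eq fin_num_measure.
Qed.

Lemma charge_integral_dist_le nu f g e : bounded_measurable f ->
  bounded_measurable g -> (forall x, `|f x - g x| <= e) ->
  `|charge_integral nu f - charge_integral nu g| <= e * charge_norm nu.
Proof.
move=> bf bg fge; rewrite -charge_integralB//.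
apply: normr_charge_integral_le => //.
exact: measurable_funB bf.1 bg.1.
Qed.

End charge_integral_theory.

(** * Image of a signed measure *)
Section pushforward_charge.
Context d1 d2 (T1 : measurableType d1) (T2 : measurableType d2) (R : realType).
Context (f : T1 -> T2) (mf : measurable_fun [set: T1] f).
Context (nu : {charge set T1 -> \bar R}).

(** The canonical instance is named because it takes the proof [mf], which
    unification cannot recover from the function [pushforward nu f]. *)
Definition pushforward_charge : {charge set T2 -> \bar R} :=
  measure_function_pushforward__canonical__charge_Charge nu mf.

Lemma bounded_measurable_comp (g : T2 -> R) : bounded_measurable g ->
  bounded_measurable (g \o f).
Proof.
by case=> mg [M gM]; split; [exact: measurableT_comp|exists M => x; exact: gM].
Qed.

(** The images of the two Jordan parts of [nu] need not be the Jordan parts of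
    the image of [nu] (they may overlap), but their difference is that image,
    which is all that [charge_integralE] asks for. *)
Lemma charge_integral_pushforward (g : T2 -> R) : bounded_measurable g ->
  charge_integral pushforward_charge g = charge_integral nu (g \o f).
Proof.
move=> bg; pose p := charge_pos nu; pose n := charge_neg nu.
have foo (m : {finite_measure set T1 -> \bar R}) : (m [set: T1] < +oo)%E.
  by rewrite ltey_eq fin_num_measure.
pose push (m : {measure set T1 -> \bar R}) : {measure set T2 -> \bar R} :=
  measure_function_pushforward__canonical__measure_function_Measure m mf.
rewrite (@charge_integralE _ _ _ _ (push p) (push n))//; last 3 first.
- exact: foo.
- exact: foo.
- move=> A mA.
  have mfA : measurable (f @^-1` A).
    by rewrite -[X in measurable X]setTI; exact: mf.
  by rewrite /pushforward_charge /= /pushforward charge_jordanE.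
have ipush (m : {finite_measure set T1 -> \bar R}) :
    \int[push m]_x g x = \int[m]_x g (f x).
  rewrite /Rintegral (@integral_pushforward _ _ _ _ _ _ mf)//=.
  - by apply/measurable_EFinP; case: bg.
  - apply: bounded_measurable_integrable; first exact: foo.
    exact: bounded_measurable_comp.
by rewrite /charge_integral !ipush.
Qed.

End pushforward_charge.

(** * The similarity form under almost isometric maps *)
Section similarity_form.
Context {R : realType}.

Lemma normr_expRN_le1 (a : R) : 0 <= a -> `|expR (- a)| <= 1.
Proof.
by move=> a0; rewrite ger0_norm ?expR_ge0// -expR0 ler_expR oppr_le0.
Qed.

(** For [a <= b], the difference is [expR (- a) * (1 - expR (a - b))], and
    [1 - expR t <= - t]. *)
Lemma expRN_lipschitz (a b : R) : 0 <= a -> 0 <= b ->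
  `|expR (- a) - expR (- b)| <= `|a - b|.
Proof.
wlog ab : a b / a <= b.
  move=> h a0 b0; have [ab|/ltW ba] := leP a b; first exact: h.
  by rewrite distrC (distrC a); exact: h.
move=> a0 b0; rewrite [leRHS]distrC !ger0_norm ?subr_ge0 ?ler_expR ?lerN2//.
have -> : - b = - a + (a - b) by lra.
rewrite expRD.
have := expR_ge1Dx (a - b); have := expR_gt0 (- a).
have : expR (- a) <= 1 by rewrite -expR0 ler_expR oppr_le0.
nra.
Qed.

Lemma mdist_lipschitz (T : metricType R) (x y z : T) :
  `|mdist x y - mdist x z| <= mdist y z.
Proof.
have := metric_triangle x y z; have := metric_triangle x z y.
rewrite (metric_sym z y) ler_norml => *; apply/andP; split; lra.
Qed.

Lemma lipschitz_measurable (T : pmetricType R) (f : borel T -> R) (C : R) :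
  (forall x y : T, `|f x - f y| <= C * mdist x y) ->
  measurable_fun [set: borel T] f.
Proof.
move=> fC.
(* A positive constant, so that one can divide by it. *)
have fC1 (x y : T) : `|f x - f y| <= (`|C| + 1) * mdist x y.
  rewrite (le_trans (fC x y))// ler_wpM2r ?mdist_ge0//.
  by rewrite (le_trans (ler_norm _))// lerDl.
have cf : continuous (f : T -> R).
  move=> x; apply/cvgrPdist_lt => e e0.
  have e'0 : 0 < e / (`|C| + 1) by rewrite divr_gt0// ltr_wpDl.
  apply: filterS (nbhsx_ballx x _ e'0) => y; rewrite ballEmdist/= => xy.
  by rewrite (le_lt_trans (fC1 _ _))// mulrC -ltr_pdivlMr// ltr_wpDl.
apply: (measurability _ (RGenOpens.measurableE R)) => _ [_ [a [b ->] <-]].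
rewrite setTI; apply: sub_sigma_algebra.
exact: (open_comp (fun x _ => cf x) (interval_open _ _)).
Qed.

Definition similarity {T : metricType R} (x y : T) : R := expR (- mdist x y).

Lemma bounded_measurable_similarity (T : pmetricType R) (y : T) :
  bounded_measurable (fun x : borel T => similarity x y).
Proof.
split; last by exists 1 => x; exact/normr_expRN_le1/mdist_ge0.
apply: (@lipschitz_measurable _ _ 1) => x z; rewrite mul1r.
rewrite (le_trans (expRN_lipschitz _ _))// ?mdist_ge0//.
by rewrite metric_sym (metric_sym z) mdist_lipschitz.
Qed.

(** The inner integral of the similarity form is again bounded and measurable,
    so that the outer one makes sense. Measurability comes from the Lipschitz
    bound [charge_norm nu], inherited from the 1-Lipschitz similarity. *)
Lemma bounded_measurable_potential d (X : measurableType d) (T : pmetricType R)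
    (nu : {charge set X -> \bar R}) (f : X -> borel T) :
  measurable_fun [set: X] f ->
  bounded_measurable
    (fun y : borel T => charge_integral nu (fun x => similarity (f x : T) y)).
Proof.
move=> mf.
have bk (y : T) : bounded_measurable (fun x => similarity (f x : T) y).
  exact (bounded_measurable_comp mf (bounded_measurable_similarity (y : T))).
split; last first.
  exists (1 * charge_norm nu) => y; apply: normr_charge_integral_le.
    by case: (bk y).
  by move=> x; exact/normr_expRN_le1/mdist_ge0.
apply: (@lipschitz_measurable _ _ (charge_norm nu)) => y z; rewrite mulrC.
apply: charge_integral_dist_le => // x.
by rewrite (le_trans (expRN_lipschitz _ _))// ?mdist_ge0// mdist_lipschitz.
Qed.

Lemma similarity_form_pushforward (T U : pmetricType R)
    (f : borel T -> borel U) (mf : measurable_fun [set: borel T] f)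
    (mu : signed_measure T) :
  let nu : signed_measure U := pushforward_charge mf mu in
  similarity_form nu nu = charge_integral mu (fun y =>
    charge_integral mu (fun x => similarity (f x : U) (f y))).
Proof.
rewrite /similarity_form -[RHS](charge_integral_pushforward mf mu
  (bounded_measurable_potential mu mf)).
congr charge_integral; apply/funext => y.
exact (charge_integral_pushforward mf mu
  (bounded_measurable_similarity (y : U))).
Qed.

(** Since [a |-> expR (- a)] is 1-Lipschitz on nonnegative reals, a map that
    changes distances by at most [e] changes the integrand by at most [e], and
    each of the two integrations costs a factor [charge_norm mu]. *)
Lemma similarity_form_distortion (T U : pmetricType R)
    (f : borel T -> borel U) (mf : measurable_fun [set: borel T] f)
    (mu : signed_measure T) (e : R) :
  (forall x y : T, `|mdist (f x : U) (f y) - mdist x y| <= e) ->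
  let nu : signed_measure U := pushforward_charge mf mu in
  `|similarity_form nu nu - similarity_form mu mu| <=
    e * charge_norm mu ^+ 2.
Proof.
move=> fe /=; rewrite similarity_form_pushforward expr2 mulrA.
have bp := bounded_measurable_potential mu mf.
apply: charge_integral_dist_le.
- exact (bounded_measurable_comp mf bp).
- exact (bounded_measurable_potential mu (@measurable_id _ (borel T) setT)).
- move=> y; apply: charge_integral_dist_le.
  + exact (bounded_measurable_comp mf
      (bounded_measurable_similarity (f y : U))).
  + exact: bounded_measurable_similarity.
  + move=> x; rewrite (le_trans _ (fe x y))//.
    by apply: expRN_lipschitz; exact: mdist_ge0.
Qed.

Lemma magnitude_ubound (T : pmetricType R) (mu : signed_measure T) :
  similarity_form mu mu != 0 ->
  (((fine (mu [set: T])) ^+ 2 / similarity_form mu mu)%:E <= magnitude T)%E.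
Proof. by move=> Z0; apply: ereal_sup_ubound; exists mu. Qed.

(** The case of distortion 0: the image of [mu] has the same mass and the same
    value of the similarity form as [mu]. *)
Lemma le_magnitude_isometry (T U : pmetricType R) (f : borel T -> borel U) :
  measurable_fun [set: borel T] f ->
  (forall x y : T, mdist (f x : U) (f y) = mdist x y) ->
  (magnitude T <= magnitude U)%E.
Proof.
move=> mf fiso; apply: ge_ereal_sup => _ [mu Z0 <-].
pose nu : signed_measure U := pushforward_charge mf mu.
have ZE : similarity_form nu nu = similarity_form mu mu.
  apply/eqP; rewrite -subr_eq0 -normr_le0 -(mul0r (charge_norm mu ^+ 2)).
  apply: similarity_form_distortion => x y.
  by rewrite fiso subrr normr0.
by rewrite -ZE; apply: (@magnitude_ubound U nu); rewrite ZE.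
Qed.

(** Taking images preserves the mass [m], and the quotient [m ^+ 2 / z] is
    continuous in [z] at a nonzero value of the similarity form, so a value of
    the quotient for [T] is almost reached in every space that receives a map
    from [T] with small enough distortion. *)
Lemma magnitude_lower_approx (T : pmetricType R) (mu : signed_measure T)
    (r : R) :
  similarity_form mu mu != 0 ->
  r < (fine (mu [set: T])) ^+ 2 / similarity_form mu mu ->
  exists2 e : R, 0 < e & forall (U : pmetricType R) (f : borel T -> borel U),
    measurable_fun [set: borel T] f ->
    (forall x y : T, `|mdist (f x : U) (f y) - mdist x y| <= e) ->
    (r%:E <= magnitude U)%E.
Proof.
set Z := similarity_form mu mu; set m := fine _ => Z0 rZ.
have cZ : (fun z => m ^+ 2 / z) z @[z --> Z] --> m ^+ 2 / Z.
  by apply: cvgM; [exact: cvg_cst|exact: cvgV].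
have /nbhs_ballP[e /= e0 eP] : \forall z \near Z, z != 0 /\ r < m ^+ 2 / z.
  near=> z; split; near: z.
    exact: cvgr_neq0 cvg_id Z0.
  exact: cvgr_gt cZ _ rZ.
(* The added 1 covers the case of a null measure. *)
have V0 : 0 < charge_norm mu ^+ 2 + 1 by rewrite ltr_wpDl ?sqr_ge0.
exists (e / (charge_norm mu ^+ 2 + 1)); first exact: divr_gt0.
move=> U f mf fe.
pose nu : signed_measure U := pushforward_charge mf mu.
have /eP[Z'0 rZ'] : ball Z e (similarity_form nu nu).
  rewrite /ball/= distrC (le_lt_trans (similarity_form_distortion mf mu fe))//.
  by rewrite -mulrA gtr_pMr// mulrC ltr_pdivrMr// mul1r ltrDl.
apply: le_trans (magnitude_ubound Z'0).
by rewrite lee_fin ltW.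
Unshelve. all: by end_near. Qed.

End similarity_form.

(** * Convergence to a supremum *)
Section ereal_cvg.
Context {R : realType}.

(** It is enough to bound [u] from below by the reals smaller than a member of
    [S], because every real smaller than the supremum is smaller than a member.
    The three cases are a finite supremum, [+oo], and [-oo]. *)
Lemma cvg_ereal_sup (u : nat -> \bar R) (S : set \bar R) :
  (forall k, u k <= ereal_sup S)%E ->
  (forall s (r : R), S s -> (r%:E < s)%E ->
    \forall k \near \oo, (r%:E <= u k)%E) ->
  u @ \oo --> ereal_sup S.
Proof.
move=> uS Su.
have {Su} lbu (r : R) : (r%:E < ereal_sup S)%E ->
    \forall k \near \oo, (r%:E <= u k)%E.
  by move=> /ereal_sup_gt[s Ss rs]; exact: Su rs.
move: uS lbu; case: (ereal_sup S) => [l| |] uS lbu A /=.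
- move=> lA; have /nbhs_ballP[e /= e0 eA] : nbhs l (A \o EFin) by exact: lA.
  have /lbu : ((l - e / 2)%:E < l%:E)%E by rewrite lte_fin; lra.
  apply: filterS => k; rewrite /preimage/=; have := uS k.
  case: (u k) => [x| |]; rewrite ?lee_fin ?leye_eq ?leeNy_eq// => xl lx.
  have : ball l e x; last exact: eA.
  by rewrite /ball/= ltr_norml; apply/andP; split; lra.
- move=> [M [_ MA]]; have /lbu : ((M + 1)%:E < +oo)%E by rewrite ltry.
  apply: filterS => k lx; apply: MA; apply: lt_le_trans lx.
  by rewrite lte_fin ltrDl.
- move=> /nbhs_singleton A1; exists 0%N => // k _ /=.
  by have := uS k; rewrite leeNy_eq => /eqP ->.
Qed.

End ereal_cvg.

(** * Measurable maps with finite range *)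
Section finite_net.
Context {R : realType}.

Lemma measurable_mdist_lt (T : pmetricType R) (c : T) (e : R) :
  measurable_fun [set: borel T] (fun x : borel T => mdist c (x : T) < e).
Proof.
apply: measurable_fun_ltr; last exact: measurable_cst.
by apply: (@lipschitz_measurable _ _ _ 1) => x y; rewrite mul1r mdist_lipschitz.
Qed.

(** A point is sent to the value of [a] at the first element of the net [s]
    that is [e]-close to it. Being a finite combination of tests on measurable
    sets, such a map is measurable whatever [a] is. *)
Lemma finite_range_approx (T U : pmetricType R) (a : T -> U) (e : R)
    (s : seq T) :
  exists2 f : borel T -> borel U, measurable_fun [set: borel T] f &
    forall x : T, (exists2 c, c \in s & mdist c x < e) ->
      exists2 c, mdist c x < e & f x = a c.
Proof.
elim: s => [|c s [f mf fs]].
  by exists (cst point) => // x [].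
exists (fun x => if mdist c (x : T) < e then a c else f x).
  apply: measurable_fun_ifT => //; exact: measurable_mdist_lt.
move=> x [c']; case: ifPn => [cx|cx]; first by exists c.
rewrite inE => /predU1P[->|c's c'x]; first by rewrite (negbTE cx).
by apply: fs; exists c'.
Qed.

Lemma compact_finite_net (T : pmetricType R) (e : R) : 0 < e ->
  compact [set: T] ->
  exists s : seq T, forall x, exists2 c, c \in s & mdist c x < e.
Proof.
move=> e0; rewrite compact_cover => /(_ T setT (fun c => (ball c e)°)).
case=> [c _|x _|s _ sP]; [exact: open_interior| |].
  by exists x => //; rewrite /interior; exact: nbhsx_ballx.
exists s => x; have [c cs /interior_subset] := sP x I.
by rewrite ballEmdist; exists c.
Qed.

End finite_net.

(** * Subspaces at small Hausdorff distance *)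
Section subspace.
Context {R : realType}.

Lemma isometry_measurable (T U : pmetricType R) (f : borel T -> borel U) :
  (forall x y : T, mdist (f x : U) (f y) = mdist x y) ->
  measurable_fun [set: borel T] f.
Proof.
move=> fiso; apply: (@measurability _ _ (borel T) (borel U) setT f (@open U)).
  by [].
move=> _ [V oV <-].
rewrite setTI; apply: sub_sigma_algebra.
apply: (@open_comp T U) => // x _; apply/cvg_ballP => e e0.
apply: filterS (nbhsx_ballx (x : T) e e0) => y.
by rewrite !ballEmdist/= fiso.
Qed.

Lemma le_magnitude_subspace (A : pmetricType R) (S : set A) (S0 : S !=set0) :
  (magnitude (subspace_of S0) <= magnitude A)%E.
Proof.
pose i : borel (subspace_of S0) -> borel A := fun x => \val x.
apply: (@le_magnitude_isometry _ _ _ i) => //.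
exact: isometry_measurable.
Qed.

Lemma hausdorff_dist_lt (A : metricType R) (S : set A) (e : R) (x : A) :
  (hausdorff_dist S [set: A] < e%:E)%E -> exists2 y, S y & mdist x y < e.
Proof.
rewrite /hausdorff_dist gt_max => /andP[_ Se].
have /ereal_inf_lt[_ [y Sy <-]] : (dist_to_set x S < e%:E)%E.
  by apply: le_lt_trans Se; apply: ereal_sup_ubound; exists x.
by rewrite lte_fin; exists y.
Qed.

(** Attach to every point [c] of [A] some [a c] in [S] with [d(c, a c) < e], and
    send [x] to [a c] for a nearby [c] in a finite [e]-net. Then [x] moves by
    less than [2 * e], so distances change by less than [4 * e]. *)
Lemma subspace_almost_isometry (A : pmetricType R) (S : set A) (S0 : S !=set0)
    (e : R) : 0 < e -> compact [set: A] ->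
  (hausdorff_dist S [set: A] < e%:E)%E ->
  exists2 f : borel A -> borel (subspace_of S0),
    measurable_fun [set: borel A] f &
    forall x y : A, `|mdist (f x : subspace_of S0) (f y) - mdist x y| <= 4 * e.
Proof.
move=> e0 cA Se.
have [s sP] := compact_finite_net e0 cA.
have near_S (c : A) : exists a : subspace_of S0, mdist c (\val a) < e.
  have [y Sy cy] := hausdorff_dist_lt c Se.
  by exists (exist _ y (mem_set Sy)).
have [a aP] := choice near_S.
have [f mf fP] := finite_range_approx a e s.
exists f => // x y.
have f2 (z : A) : mdist z (\val (f z : subspace_of S0)) < 2 * e.
  have [c cz ->] := fP z (sP z).
  have := metric_triangle z c (\val (a c)); rewrite (metric_sym z c).
  by have := aP c; lra.
have := f2 x; have := f2 y.
set u := \val (f x : subspace_of S0); set v := \val (f y : subspace_of S0).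
have -> : mdist (f x : subspace_of S0) (f y) = mdist u v by [].
have := mdist_lipschitz u v y; have := mdist_lipschitz y u x.
rewrite !ler_norml (metric_sym y u) (metric_sym v y) (metric_sym u x).
rewrite (metric_sym y x) => /andP[? ?] /andP[? ?] ? ?.
by apply/andP; split; lra.
Qed.

End subspace.

Theorem corollary2p7 (R : realType) (A : pmetricType R) (A_ : nat -> set A)
    (A_neq0 : forall k, A_ k !=set0) :
  compact [set: A] ->
  positive_definite A ->
  (forall k, compact (A_ k)) ->
  hausdorff_dist (A_ k) [set: A] @[k --> \oo] --> 0%:E ->
  magnitude (subspace_of (A_neq0 k)) @[k --> \oo] --> magnitude A.
Proof.
move=> cA _ _ dA0; apply: cvg_ereal_sup => [k|_ r [mu Z0 <-]].
  exact: le_magnitude_subspace.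
rewrite lte_fin => /(magnitude_lower_approx Z0)[e e0 eP].
have e40 : 0 < e / 4 by lra.
have lt0e : nbhs (0%:E : \bar R) [set x | (x < (e / 4)%:E)%E].
  have : nbhs (0 : R) [set x | x < e / 4] by exact: lt_nbhsl.
  by apply: filterS => x; rewrite /= lte_fin.
have : \forall k \near \oo, (hausdorff_dist (A_ k) [set: A] < (e / 4)%:E)%E.
  exact: (dA0 _ lt0e).
apply: filterS => k Ak.
have [f mf fe] := subspace_almost_isometry (A_neq0 k) e40 cA Ak.
by apply: (eP _ f mf) => x y; rewrite (le_trans (fe x y))//; lra.
Qed.
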